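(* There exists an absolute constant $C_B>0$ such that for every $n\ge1$ and every non-constant $f:\{-1,1\}^n\to\{-1,1\}$, writing $$T(f)=\sum_{i=1}^n\frac{\mathrm{Inf}_i(f)}{1+\log(1/\mathrm{Inf}_i(f))},\qquad r_{\mathrm{Tal}}=\frac{\mathrm{Var}(f)}{T(f)},$$ both the inner and the outer vertex boundaries satisfy $$\mu(\partial^{+}f)\ge\frac{r_{\mathrm{Tal}}}{C_B\log\frac{C_B}{r_{\mathrm{Tal}}}}\mathrm{Var}(f)\quad\text{and}\quad \mu(\partial^{-}f)\ge\frac{r_{\mathrm{Tal}}}{C_B\log\frac{C_B}{r_{\mathrm{Tal}}}}\mathrm{Var}(f).$$
   Context: $\mu$ is the uniform probability measure on $\{-1,1\}^n$; $\mathrm{Var}$ is taken with respect to $\mu$. $y^{\oplus i}$ is $y$ with the $i$-th coordinate flipped. $\mathrm{Inf}_i(f)=\mu(\{y: f(y)\ne f(y^{\oplus i})\})$; in $T(f)$ a term with $\mathrm{Inf}_i(f)=0$ is read as $0$. The inner vertex boundary is $\partial^+f=\{y: \exists i,\ f(y)=1,\ f(y^{\oplus i})=-1\}$ and the outer vertex boundary is $\partial^-f=\{y:\exists i,\ f(y)=-1,\ f(y^{\oplus i})=1\}$. $\log$ is the natural logarithm. *)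

(* Defs.v *)
From mathcomp Require Import all_boot all_order all_algebra.
From mathcomp Require Import reals exp.

Set Implicit Arguments.
Unset Strict Implicit.
Unset Printing Implicit Defensive.

Import Order.TTheory GRing.Theory Num.Theory.
Local Open Scope ring_scope.

(* The two-point set {-1,1} is encoded by bool: true stands for 1 and false
   for -1.  Wherever real values matter, the encoding is undone by [pm1]. *)
Definition cube (n : nat) : finType := {ffun 'I_n -> bool}.

Definition pm1 (R : realType) (b : bool) : R := if b then 1 else -1.

Definition flip (n : nat) (y : cube n) (i : 'I_n) : cube n :=
  [ffun j => if j == i then ~~ y j else y j].

Definition mu (R : realType) (n : nat) (A : {set cube n}) : R :=
  #|A|%:R / #|cube n|%:R.

Definition expect (R : realType) (n : nat) (g : cube n -> R) : R :=
  \sum_(y : cube n) g y * mu R [set y].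

Definition variance (R : realType) (n : nat) (g : cube n -> R) : R :=
  expect (fun y => (g y - expect g) ^+ 2).

(* The values of f are read in {-1,1}, so Var f = 4 p (1 - p), p = mu(f = 1). *)
Definition Var (R : realType) (n : nat) (f : cube n -> bool) : R :=
  variance (fun y => pm1 R (f y)).

Definition Inf (R : realType) (n : nat) (f : cube n -> bool) (i : 'I_n) : R :=
  mu R [set y : cube n | f y != f (flip y i)].

Definition inner_boundary (n : nat) (f : cube n -> bool) : {set cube n} :=
  [set y : cube n | [exists i : 'I_n, (f y == true) && (f (flip y i) == false)]].

Definition outer_boundary (n : nat) (f : cube n -> bool) : {set cube n} :=
  [set y : cube n | [exists i : 'I_n, (f y == false) && (f (flip y i) == true)]].

Definition nonconstant (n : nat) (f : cube n -> bool) : Prop :=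
  ~ (exists b : bool, forall y : cube n, f y = b).

(* The coordinates with zero influence contribute 0. *)
Definition talagrand_sum (R : realType) (n : nat) (f : cube n -> bool) : R :=
  \sum_(i < n | Inf R f i != 0) Inf R f i / (1 + ln (1 / Inf R f i)).

Definition r_Tal (R : realType) (n : nat) (f : cube n -> bool) : R :=
  Var R f / talagrand_sum R f.

(* Main.v *)
Require Import Defs.
From mathcomp Require Import all_boot all_order all_algebra.
From mathcomp Require Import reals sequences exp.
From mathcomp Require Import ring lra zify.

(** Write F for the +-1 valued version of f, reveal the coordinates of a uniform
point one at a time in a uniformly random order, and follow the martingale
M_J = E[F | coordinates in J] ([condE J F]).  Revealing the coordinate i after
the set J moves it by +-E[D_i F | J], where D_i F ([cube_deriv]) is the discrete
derivative, so that Var f is the sum over i of the average over J of the second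
moment of E[D_i F | J] ([Var_energy]).  Let D be the boundary under study,
lam > 0 a density threshold and N_J = E[1_D | J].  With L_i = log (1 / Inf_i)
and a cutoff A, the steps (i, J) are divided into three classes.

- Early steps, at which a fraction at least A / (1 + L_i) of the coordinates is
  still to come.  D_i F takes its values in {-1, 0, 1} and has a support of
  measure Inf_i, so by hypercontractivity ([noise_norm_small_set]) conditioning
  at time 1 - x of the process shrinks its second moment to at most
  Inf_i * exp (- L_i * x / 4).  The total is at most 20 * exp (- A / 8) * T(f)
  ([early_energy]).  With A = 0 all steps are early, and this is Talagrand's
  inequality Var f <= 20 T(f).

- Steps at which N_J >= lam.  N is a martingale that ends at 1_D, so this
  happens with probability at most mu(D) / lam, and after it the martingale M,
  which is bounded by 1, has at most one unit of variance left.  A convex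
  function of (M, N) turns this into a bound mu(D) / lam without stopping times
  ([energy_high_density]).

- Late steps at which N_J < lam.  Each edge cut by f has exactly one endpoint in
  D, so D_i F can be replaced by a function supported on D that has the same
  conditional expectation.  Cauchy-Schwarz then gains the factor N_J < lam
  ([energy_low_density]), and as a random J is late with probability at most
  (A + 2) / (1 + L_i), the total is at most 2 * lam * (A + 2) * T(f)
  ([late_energy]).

With r = Var f / T(f), the choice A = 8 * log (40 / r) makes the first class
worth Var f / 2, and lam = r / (8 (A + 2)) makes the third worth Var f / 4.
Hence mu(D) >= lam * Var f / 4 = r * Var f / (32 (A + 2)). *)

Set Implicit Arguments.
Unset Strict Implicit.
Unset Printing Implicit Defensive.

Import Order.TTheory GRing.Theory Num.Theory.
Local Open Scope ring_scope.

(** * Expectation on the cube *)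

Section Expectation.
Variables (R : realType) (n : nat).
Implicit Types (g h : cube n -> R) (x y z : cube n) (S J K : {set 'I_n}).

Lemma card_cube_gt0 : 0 < #|cube n|%:R :> R.
Proof. by rewrite ltr0n card_ffun card_bool card_ord expn_gt0. Qed.

Lemma expectE g : expect g = (\sum_y g y) / #|cube n|%:R.
Proof.
by rewrite /expect mulr_suml; apply: eq_bigr => y _; rewrite /mu cards1 mul1r.
Qed.

Lemma eq_expect g h : g =1 h -> expect g = expect h.
Proof. by move=> gh; apply: eq_bigr => y _; rewrite gh. Qed.

Lemma expectD g h : expect (fun x => g x + h x) = expect g + expect h.
Proof. by rewrite !expectE big_split mulrDl. Qed.

Lemma expectZ (c : R) g : expect (fun x => c * g x) = c * expect g.
Proof. by rewrite !expectE mulrA mulr_sumr. Qed.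

Lemma expectN g : expect (fun x => - g x) = - expect g.
Proof. by rewrite !expectE sumrN mulNr. Qed.

Lemma expect_cst (c : R) : expect (fun _ : cube n => c) = c.
Proof.
rewrite expectE sumr_const -[c *+ _]mulr_natr mulfK //.
exact: lt0r_neq0 card_cube_gt0.
Qed.

Lemma expect_ge0 g : (forall x, 0 <= g x) -> 0 <= expect g.
Proof. by move=> g0; rewrite expectE divr_ge0 ?ler0n ?sumr_ge0. Qed.

Lemma le_expect g h : (forall x, g x <= h x) -> expect g <= expect h.
Proof.
move=> gh; rewrite !expectE ler_pM2r ?invr_gt0 ?card_cube_gt0 //.
exact: ler_sum.
Qed.

Lemma expect_sum (I : finType) (P : pred I) (F : I -> cube n -> R) :
  expect (fun x => \sum_(i | P i) F i x) = \sum_(i | P i) expect (F i).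
Proof.
rewrite expectE exchange_big mulr_suml; apply: eq_bigr => i _.
by rewrite expectE.
Qed.

Lemma expect_mem (A : {set cube n}) :
  expect (fun x => (x \in A)%:R) = mu R A.
Proof.
rewrite expectE /mu; congr (_ / _).
rewrite (eq_bigr (fun x : cube n => if x \in A then 1 else 0)).
  by rewrite -big_mkcond sumr_const.
by move=> x _; case: (x \in A).
Qed.

Lemma flipK i : involutive (fun x => flip x i).
Proof.
by move=> x; apply/ffunP => j; rewrite !ffunE; case: eqP => // _; rewrite negbK.
Qed.

Lemma expect_flip i g : expect (fun x => g (flip x i)) = expect g.
Proof.
rewrite !expectE; congr (_ / _).
by rewrite [RHS](reindex_inj (inv_inj (@flipK i))).
Qed.

Lemma expect_odd i g : (forall x, g (flip x i) = - g x) -> expect g = 0.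
Proof.
move=> godd; have := expect_flip i g.
by rewrite (eq_expect godd) expectN; lra.
Qed.

Lemma expect_CauchySchwarz g h :
  expect (fun x => g x * h x) ^+ 2
    <= expect (fun x => g x ^+ 2) * expect (fun x => h x ^+ 2).
Proof.
set b := expect (fun x => g x * h x).
set G := expect (fun x => g x ^+ 2); set H := expect (fun x => h x ^+ 2).
have : 0 <= expect (fun x => expect (fun y => (g x * h y - g y * h x) ^+ 2)).
  by apply: expect_ge0 => x; apply: expect_ge0 => y; apply: sqr_ge0.
have -> : expect (fun x => expect (fun y => (g x * h y - g y * h x) ^+ 2))
    = expect (fun x => H * g x ^+ 2 + (G * h x ^+ 2 + (- 2 * b) * (g x * h x))).
  apply: eq_expect => x.
  transitivity (expect (fun y => g x ^+ 2 * h y ^+ 2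
      + (h x ^+ 2 * g y ^+ 2 + (- 2 * (g x * h x)) * (g y * h y)))).
    by apply: eq_expect => y; ring.
  by rewrite !expectD !expectZ -/b -/G -/H; ring.
rewrite !expectD !expectZ -/b -/G -/H; lra.
Qed.

(** * Fourier expansion *)

Definition char S x : R := \prod_(i in S) pm1 R (x i).

Definition coef g S : R := expect (fun x => g x * char S x).

Lemma pm1_sqr b : pm1 R b ^+ 2 = 1.
Proof. by case: b; rewrite /pm1 ?sqrrN expr1n. Qed.

Lemma pm1N b : pm1 R (~~ b) = - pm1 R b.
Proof. by case: b; rewrite /pm1 ?opprK. Qed.

Lemma char0 x : char set0 x = 1.
Proof. by rewrite /char big_set0. Qed.

Lemma charU1 i K x : i \notin K -> char (i |: K) x = pm1 R (x i) * char K x.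
Proof. by move=> iK; rewrite /char big_setU1. Qed.

Lemma char_sqr S x : char S x ^+ 2 = 1.
Proof. by rewrite /char -prodrXl big1 // => i _; rewrite pm1_sqr. Qed.

Lemma flip_eq i x : flip x i i = ~~ x i.
Proof. by rewrite ffunE eqxx. Qed.

Lemma flip_neq i j x : j != i -> flip x i j = x j.
Proof. by rewrite ffunE => /negbTE ->. Qed.

Lemma char_flip_notin i S x : i \notin S -> char S (flip x i) = char S x.
Proof.
move=> iS; apply: eq_bigr => j jS; rewrite flip_neq //.
by apply: contraNneq iS => <-.
Qed.

Lemma char_flip_in i S x : i \in S -> char S (flip x i) = - char S x.
Proof.
move=> iS; have iD : i \notin S :\ i by rewrite setD11.
by rewrite -(setD1K iS) !charU1 // char_flip_notin // flip_eq pm1N mulNr.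
Qed.

Lemma expect_char_mul S K :
  expect (fun x => char S x * char K x) = (S == K)%:R.
Proof.
have [->|SK] := eqVneq S K.
  rewrite -[RHS](expect_cst 1); apply: eq_expect => x.
  by rewrite -expr2 char_sqr.
have /existsP[i iSK] : [exists i, (i \in S) != (i \in K)].
  apply: contraNT SK => /existsPn SK; apply/eqP/setP => i.
  by apply/eqP; rewrite -[_ == _]negbK SK.
apply: (@expect_odd i) => x; move: iSK.
by case: (boolP (i \in S)) => iS; case: (boolP (i \in K)) => iK //= _;
  rewrite ?(char_flip_in _ iS) ?(char_flip_in _ iK)
    ?(char_flip_notin _ iS) ?(char_flip_notin _ iK) ?mulrN ?mulNr.
Qed.

Lemma expect_char S : expect (char S) = (S == set0)%:R.
Proof.
by rewrite -expect_char_mul; apply: eq_expect => x; rewrite char0 mulr1.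
Qed.

(** Expanding the product of the factors 1 + x_i y_i, which vanishes unless
    x = y, produces this sum over S. *)
Lemma sum_char_mul x y :
  \sum_S char S x * char S y = #|cube n|%:R * (x == y)%:R.
Proof.
transitivity (\prod_i (pm1 R (x i) * pm1 R (y i) + 1)).
  rewrite bigA_distr; apply: eq_big => // S _.
  rewrite /char -big_split /= [RHS]big_mkcond.
  by rewrite [LHS]big_mkcond; apply: eq_bigr => i _; case: ifP.
have [->|xy] := eqVneq x y.
  rewrite (eq_bigr (fun=> 2)); last by move=> i _; rewrite -expr2 pm1_sqr.
  by rewrite prodr_const card_ord mulr1 card_ffun card_bool card_ord natrX.
have /existsP[i] : [exists i, x i != y i].
  apply: contraNT xy => /existsPn xy; apply/eqP/ffunP => i.
  by apply/eqP; rewrite -[_ == _]negbK xy.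
rewrite (bigD1 i) //= => xyi; rewrite mulr0 (_ : _ + 1 = 0) ?mul0r //.
by move: xyi; case: (x i); case: (y i); rewrite //= /pm1 ?mulr1 ?mul1r addNr.
Qed.

Lemma fourier_expansion g x : g x = \sum_S coef g S * char S x.
Proof.
transitivity (\sum_y g y * ((#|cube n|%:R * (x == y)%:R) / #|cube n|%:R)).
  rewrite (bigD1 x) //= eqxx mulr1 mulfV ?lt0r_neq0 ?card_cube_gt0 // mulr1.
  rewrite big1 ?addr0 // => y /negbTE yx.
  by rewrite eq_sym yx mulr0 mul0r mulr0.
under eq_bigr do rewrite -sum_char_mul mulr_suml mulr_sumr.
rewrite exchange_big; apply: eq_bigr => S _.
rewrite /coef expectE mulrAC mulr_suml mulr_suml; apply: eq_bigr => y _.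
by ring.
Qed.

Lemma expect_sqr_char_sum (P : pred {set 'I_n}) (c : {set 'I_n} -> R) :
  expect (fun x => (\sum_(S | P S) c S * char S x) ^+ 2)
    = \sum_(S | P S) c S ^+ 2.
Proof.
transitivity (\sum_(S | P S) \sum_(K | P K)
    c S * c K * expect (fun x => char S x * char K x)).
  under eq_expect => x do rewrite expr2 mulr_suml.
  rewrite expect_sum; apply: eq_bigr => S _.
  under eq_expect => x do rewrite mulr_sumr.
  rewrite expect_sum; apply: eq_bigr => K _.
  by rewrite -expectZ; apply: eq_expect => x; ring.
apply: eq_bigr => S PS; rewrite (bigD1 S) //= expect_char_mul eqxx mulr1.
rewrite -expr2 big1 ?addr0 // => K /andP[_ KS].
by rewrite expect_char_mul eq_sym (negbTE KS) mulr0.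
Qed.

Lemma parseval g : expect (fun x => g x ^+ 2) = \sum_S coef g S ^+ 2.
Proof.
rewrite -(expect_sqr_char_sum xpredT); apply: eq_expect => x.
by rewrite -fourier_expansion.
Qed.
End Expectation.

(** * Hypercontractivity *)

Section Hypercontractivity.
Variables (R : realType) (n : nat).
Implicit Types (g h : cube n -> R) (x : cube n) (S J K : {set 'I_n}).

Lemma sum_subsetU1 (i : 'I_n) K (F : {set 'I_n} -> R) : i \notin K ->
  \sum_(S : {set 'I_n} | S \subset i |: K) F S
    = \sum_(S : {set 'I_n} | S \subset K) F S
      + \sum_(S : {set 'I_n} | S \subset K) F (i |: S).
Proof.
move=> iK; rewrite (bigID (fun S : {set 'I_n} => i \in S)) /= addrC; congr (_ + _).
  by apply: eq_bigl => S; rewrite -[in RHS](setU1K iK) subsetD1.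
rewrite (reindex_onto (fun S : {set 'I_n} => i |: S) (fun S => S :\ i)) /=; last first.
  by move=> S /andP[_ iS]; rewrite setD1K.
apply: eq_bigl => S; rewrite setU11 andbT; apply/andP/idP => [[SK /eqP SE]|SK].
  have iS : i \notin S by rewrite -SE setD11.
  apply/subsetP => j jS; have := subsetP SK j.
  rewrite !inE jS orbT => /(_ isT)/orP[/eqP ji|//].
  by rewrite -ji jS in iS.
have iS : i \notin S by apply: contra iK => /(subsetP SK).
by rewrite setU1K // setUS.
Qed.

(** The (4,2)-hypercontractive inequality, stated without a noise operator: the
    weights 3 ^ #|S| sit on the right.  By induction on K: in A + x_i B the odd
    powers of x_i average out, and E (A^2 B^2) is split by Cauchy-Schwarz, which
    leaves a^2 + 6ab + b^2 <= (a + 3b)^2. *)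
Lemma bonami (c : {set 'I_n} -> R) K :
  expect (fun x => (\sum_(S : {set 'I_n} | S \subset K) c S * char R S x) ^+ 4)
    <= (\sum_(S : {set 'I_n} | S \subset K) 3 ^+ #|S| * c S ^+ 2) ^+ 2.
Proof.
move Em: #|K| => m; elim: m K c Em => [|m IH] K c Em.
  move/eqP: Em; rewrite cards_eq0 => /eqP ->.
  have E (F : {set 'I_n} -> R) : \sum_(S : {set 'I_n} | S \subset set0) F S = F set0.
    by under eq_bigl do rewrite subset0; rewrite big_pred1_eq.
  rewrite E cards0 expr0 mul1r.
  rewrite (@eq_expect _ _ _ (fun=> c set0 ^+ 4)) ?expect_cst; first by lra.
  by move=> x; rewrite E char0 mulr1.
have [i iK] : exists i, i \in K by apply/set0Pn; rewrite -card_gt0 Em.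
have Ki : i \notin K :\ i by rewrite setD11.
have cK : #|K :\ i| = m by apply/eqP; rewrite -eqSS -Em (cardsD1 i K) iK.
have notin S : S \subset K :\ i -> i \notin S.
  by move=> SK; apply: contra Ki => /(subsetP SK).
rewrite -(setD1K iK); move: (K :\ i) Ki cK notin => {iK Em}K iK cK notin.
pose A x := \sum_(S : {set 'I_n} | S \subset K) c S * char R S x.
pose B x := \sum_(S : {set 'I_n} | S \subset K) c (i |: S) * char R S x.
set a := \sum_(S : {set 'I_n} | S \subset K) 3 ^+ #|S| * c S ^+ 2.
set b := \sum_(S : {set 'I_n} | S \subset K) 3 ^+ #|S| * c (i |: S) ^+ 2.
have a0 : 0 <= a by apply: sumr_ge0 => S _; rewrite mulr_ge0 ?sqr_ge0 ?exprn_ge0.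
have b0 : 0 <= b by apply: sumr_ge0 => S _; rewrite mulr_ge0 ?sqr_ge0 ?exprn_ge0.
have -> : \sum_(S : {set 'I_n} | S \subset i |: K) 3 ^+ #|S| * c S ^+ 2 = a + 3 * b.
  rewrite sum_subsetU1 // mulr_sumr; congr (_ + _); apply: eq_bigr => S SK.
  by rewrite cardsU1 notin // exprD expr1 mulrA.
have split x : \sum_(S : {set 'I_n} | S \subset i |: K) c S * char R S x
    = A x + pm1 R (x i) * B x.
  rewrite sum_subsetU1 // mulr_sumr; congr (_ + _); apply: eq_bigr => S SK.
  by rewrite charU1 ?notin // mulrCA.
have Afl x : A (flip x i) = A x.
  by apply: eq_bigr => S SK; rewrite char_flip_notin ?notin.
have Bfl x : B (flip x i) = B x.
  by apply: eq_bigr => S SK; rewrite char_flip_notin ?notin.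
have -> : expect (fun x =>
      (\sum_(S : {set 'I_n} | S \subset i |: K) c S * char R S x) ^+ 4)
    = expect (fun x => A x ^+ 4) + 6 * expect (fun x => A x ^+ 2 * B x ^+ 2)
      + expect (fun x => B x ^+ 4).
  rewrite -expectZ -!expectD.
  rewrite -[RHS]addr0 -[X in _ + X](@expect_odd _ _ i
    (fun x => pm1 R (x i) * (4 * (A x ^+ 3 * B x) + 4 * (A x * B x ^+ 3)))).
    rewrite -expectD; apply: eq_expect => x; rewrite split.
    have := pm1_sqr R (x i); move: (pm1 R (x i)) => p p1.
    rewrite (_ : (A x + p * B x) ^+ 4 = A x ^+ 4
      + 6 * (A x ^+ 2 * B x ^+ 2) * p ^+ 2 + B x ^+ 4 * (p ^+ 2) ^+ 2
      + p * (4 * (A x ^+ 3 * B x) + 4 * (A x * B x ^+ 3) * p ^+ 2)).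
      by rewrite p1; ring.
    by ring.
  by move=> x; rewrite Afl Bfl flip_eq pm1N mulNr.
have hA := IH K c cK; have hB := IH K (fun S => c (i |: S)) cK.
rewrite -/a -/(A _) in hA; rewrite -/b in hB.
have hAB : expect (fun x => A x ^+ 2 * B x ^+ 2) <= a * b.
  rewrite -ler_sqr ?nnegrE ?mulr_ge0 //; last first.
    by apply: expect_ge0 => x; rewrite mulr_ge0 ?sqr_ge0.
  apply: (le_trans (expect_CauchySchwarz _ _)); rewrite exprMn.
  apply: ler_pM.
  - by apply: expect_ge0 => x; apply: sqr_ge0.
  - by apply: expect_ge0 => x; apply: sqr_ge0.
  - by under eq_expect do rewrite -exprM.
  - by under eq_expect do rewrite -exprM.
apply: (le_trans (lerD (lerD hA (ler_wpM2l _ hAB)) hB)); first by lra.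
by have := sqr_ge0 b; lra.
Qed.

(** The squared L2 norm of the noise operator of correlation sqrt s applied to
    g. *)
Definition noise_norm (s : R) g := \sum_(S : {set 'I_n}) s ^+ #|S| * coef g S ^+ 2.

Lemma noise_norm_ge0 s g : 0 <= s -> 0 <= noise_norm s g.
Proof.
by move=> s0; apply: sumr_ge0 => S _; rewrite mulr_ge0 ?sqr_ge0 ?exprn_ge0.
Qed.

(** The dual of [bonami], for functions with values in {-1, 0, 1}: the
    4/3-norm is then a power of the measure of the support, and Hoelder's
    inequality reduces to two uses of Cauchy-Schwarz. *)
Lemma noise_norm_third g :
  (forall x, g x ^+ 3 = g x) ->
  noise_norm 3^-1 g ^+ 2 <= expect (fun x => g x ^+ 2) ^+ 3.
Proof.
move=> g01; set a := noise_norm 3^-1 g; set al := expect _.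
have a0 : 0 <= a by rewrite noise_norm_ge0 ?invr_ge0.
have al0 : 0 <= al by apply: expect_ge0 => x; apply: sqr_ge0.
pose G x := \sum_(S : {set 'I_n}) 3^-1 ^+ #|S| * coef g S * char R S x.
have aE : a = expect (fun x => g x * (g x ^+ 2 * G x)).
  transitivity (expect (fun x => \sum_(S : {set 'I_n})
      (3^-1 ^+ #|S| * coef g S) * (g x * char R S x))).
    rewrite expect_sum; apply: eq_bigr => S _.
    by rewrite expectZ -/(coef g S) expr2 mulrA.
  apply: eq_expect => x; rewrite mulrA -exprS g01 mulr_sumr.
  by apply: eq_bigr => S _; ring.
have G4 : expect (fun x => (G x ^+ 2) ^+ 2) <= a ^+ 2.
  have := bonami (fun S => 3^-1 ^+ #|S| * coef g S) setT.
  under [in X in _ <= X]eq_bigl do rewrite subsetT.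
  rewrite (_ : \sum_(_ | _) _ = a).
    apply: le_trans; rewrite le_eqVlt; apply/orP; left; apply/eqP.
    apply: eq_expect => x; rewrite -exprM; congr (_ ^+ _).
    by apply: eq_bigl => S; rewrite subsetT.
  apply: eq_bigr => S _.
  rewrite exprMn mulrA; congr (_ * _).
  by rewrite expr2 mulrA -exprMn mulfV ?pnatr_eq0 // expr1n mul1r.
have step1 : a ^+ 2 <= al * expect (fun x => (g x ^+ 2 * G x) ^+ 2).
  by rewrite aE; apply: expect_CauchySchwarz.
set Q := expect (fun x => (g x ^+ 2 * G x) ^+ 2) in step1.
have Q0 : 0 <= Q by apply: expect_ge0 => x; apply: sqr_ge0.
have g4 x : (g x ^+ 2) ^+ 2 = g x ^+ 2.
  by transitivity (g x * g x ^+ 3); [ring | rewrite g01; ring].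
have step2 : Q ^+ 2 <= al * a ^+ 2.
  have -> : Q = expect (fun x => g x ^+ 2 * G x ^+ 2).
    by apply: eq_expect => x; rewrite exprMn g4.
  apply: (le_trans (expect_CauchySchwarz _ _)).
  apply: ler_pM => //; try by apply: expect_ge0 => x; apply: sqr_ge0.
  by apply: le_expect => x; rewrite g4.
have [a_eq0|a_neq0] := eqVneq a 0; first by rewrite a_eq0 expr0n exprn_ge0.
have a2 : 0 < a ^+ 2 by rewrite exprn_gt0 // lt_neqAle eq_sym a_neq0.
rewrite -(ler_pM2r a2).
apply: (@le_trans _ _ ((al * Q) ^+ 2)).
  by rewrite -expr2 ler_sqr ?nnegrE ?mulr_ge0 ?sqr_ge0.
rewrite exprMn (_ : al ^+ 3 * a ^+ 2 = al ^+ 2 * (al * a ^+ 2)); last by ring.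
by apply: ler_wpM2l; rewrite ?sqr_ge0.
Qed.

(** Weighted arithmetic-geometric mean inequality between 1 and expR y, from the
    tangent line of expR at t * y. *)
Lemma expR_convex (t y : R) : 0 <= t <= 1 ->
  expR (t * y) <= 1 - t + t * expR y.
Proof.
move=> /andP[t0 t1]; set e := expR (t * y).
have e0 : 0 < e by apply: expR_gt0.
have h1 : e * (1 + (1 - t) * y) <= expR y.
  rewrite [X in _ <= expR X](_ : y = t * y + (1 - t) * y); last by ring.
  by rewrite expRD ler_pM2l // expR_ge1Dx.
have h2 : e * (1 - t * y) <= 1.
  rewrite -[X in _ <= X]expR0 -[X in _ <= expR X](subrr (t * y)) expRD ler_pM2l //.
  exact: expR_ge1Dx.
have := ler_wpM2l t0 h1.
have t1' : 0 <= 1 - t by lra.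
have := ler_wpM2l t1' h2.
by nra.
Qed.

(** Interpolation between s = 1, where the norm is expR (- L), and s = 1/3, where
    it is at most expR (- 3L / 2).  Instead of Hoelder's inequality over the
    Fourier levels, each s ^ j is bounded by the same affine function of 3 ^ - j,
    tangent where the two end values balance. *)
Lemma noise_norm_small_set g (s L : R) :
  (forall x, g x ^+ 3 = g x) -> expect (fun x => g x ^+ 2) = expR (- L) ->
  0 <= s <= 1 -> noise_norm s g <= expR (- L) * expR (- (L * (1 - s) / 4)).
Proof.
move=> g01 alE /andP[s0 s1].
set t := (1 - s) / 2.
have t01 : 0 <= t <= 1 by rewrite /t; apply/andP; split; lra.
(* Tangent line of u ^ t at u = expR (- L / 2), applied at u = 3 ^ - j; it
   bounds s ^ j because s <= expR (- 2 t) and expR (- 2) <= 1/3. *)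
have key j : s ^+ j <= (1 - t) * expR (- (t * L / 2))
    + t * expR (- (t * L / 2) + L / 2) * 3^-1 ^+ j.
  have e2 : expR (- 2 : R) <= 3^-1.
    rewrite expRN lef_pV2 ?posrE ?expR_gt0 //.
    rewrite (_ : 2 = 1 + 1 :> R) // expRD.
    have := expR_ge1Dx (1 : R); nra.
  have h1 : s ^+ j <= expR (t * (- 2 * j%:R)).
    rewrite (_ : t * _ = j%:R * (s - 1)); last by rewrite /t; field.
    rewrite expRM_natl; apply: lerXn2r; rewrite ?nnegrE ?expR_ge0 //.
    by have := expR_ge1Dx (s - 1); rewrite addrC subrK.
  apply: (le_trans h1).
  rewrite (_ : t * _ = - (t * L / 2) + t * (L / 2 - 2 * j%:R)); last by ring.
  rewrite expRD.
  apply: (le_trans (ler_wpM2l (expR_ge0 _) (expR_convex _ t01))).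
  rewrite mulrDr [_ * (1 - t)]mulrC lerD2l [_ * (t * _)]mulrCA.
  rewrite -[X in _ <= X]mulrA; apply: ler_wpM2l; first by case/andP: t01.
  rewrite !expRD -[X in _ <= X]mulrA; apply: ler_wpM2l; first exact: expR_ge0.
  apply: ler_wpM2l; first exact: expR_ge0.
  rewrite (_ : - (2 * j%:R) = j%:R * (- 2)); last by ring.
  by rewrite expRM_natl; apply: lerXn2r; rewrite ?nnegrE ?expR_ge0 ?invr_ge0.
have third : noise_norm 3^-1 g <= expR (- L) * expR (- L / 2).
  rewrite -ler_sqr ?nnegrE ?noise_norm_ge0 ?invr_ge0 ?mulr_ge0 ?expR_ge0 //.
  apply: (le_trans (noise_norm_third g01)); rewrite alE.
  rewrite -expRD -!expRM_natl; rewrite ler_expR; lra.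
apply: (@le_trans _ _ ((1 - t) * expR (- (t * L / 2)) * expR (- L)
   + t * expR (- (t * L / 2) + L / 2) * noise_norm 3^-1 g)).
  rewrite -alE parseval /noise_norm !mulr_sumr -big_split; apply: ler_sum => S _.
  apply: (le_trans (ler_wpM2r (sqr_ge0 _) (key #|S|))).
  by rewrite mulrDl !mulrA.
apply: (@le_trans _ _ ((1 - t) * expR (- (t * L / 2)) * expR (- L)
   + t * expR (- (t * L / 2) + L / 2) * (expR (- L) * expR (- L / 2)))).
  rewrite lerD2l; apply: ler_wpM2l => //.
  by case/andP: t01 => *; rewrite mulr_ge0 ?expR_ge0.
rewrite [expR (- (t * L / 2) + L / 2)]expRD.
have e1 : expR (L / 2) * expR (- L / 2) = 1.
  by rewrite -expRD mulNr subrr expR0.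
rewrite (_ : L * (1 - s) / 4 = t * L / 2); last by rewrite /t; field.
move: (expR (- (t * L / 2))) (expR (- L)) (expR (L / 2)) (expR (- L / 2)) e1.
move=> p q u v uv; rewrite le_eqVlt; apply/orP; left; apply/eqP.
rewrite (_ : t * (p * u) * (q * v) = t * p * q * (u * v)); last by ring.
by rewrite uv; ring.
Qed.
End Hypercontractivity.

(** * Conditioning on a set of coordinates *)

Section Conditioning.
Variables (R : realType) (n : nat).
Implicit Types (g h : cube n -> R) (x z : cube n) (S J K : {set 'I_n}).

Definition mix J x z : cube n := [ffun j => if j \in J then x j else z j].

Definition condE J g x : R := expect (fun z => g (mix J x z)).

Definition cube_deriv (i : 'I_n) g x : R :=
  pm1 R (x i) * (g x - g (flip x i)) / 2.

Lemma condE_char J S x :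
  condE J (char R S) x = if S \subset J then char R S x else 0.
Proof.
case: ifPn => [SJ|/subsetPn[i iS iJ]].
  rewrite -[RHS](@expect_cst R n); apply: eq_expect => z.
  by apply: eq_bigr => j jS; rewrite ffunE (subsetP SJ).
apply: (@expect_odd _ _ i) => z; rewrite -(char_flip_in R _ iS).
congr (char R S _); apply/ffunP => j; rewrite !ffunE.
by have [->|//] := eqVneq j i; rewrite (negbTE iJ).
Qed.

Lemma condE_fourier J g x :
  condE J g x = \sum_(S : {set 'I_n} | S \subset J) coef g S * char R S x.
Proof.
transitivity (expect (fun z => \sum_(S : {set 'I_n})
    coef g S * char R S (mix J x z))).
  by apply: eq_expect => z; rewrite -fourier_expansion.
rewrite expect_sum [RHS]big_mkcond; apply: eq_bigr => S _.
by rewrite expectZ -/(condE J (char R S) x) condE_char; case: ifP; rewrite ?mulr0.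
Qed.

Lemma expect_condE J g : expect (condE J g) = expect g.
Proof.
under eq_expect do rewrite condE_fourier.
rewrite expect_sum (bigD1 set0) ?sub0set //= expectZ expect_char eqxx mulr1.
rewrite big1 ?addr0.
  by apply: eq_expect => x; rewrite char0 mulr1.
by move=> S /andP[_ /negbTE S0]; rewrite expectZ expect_char S0 mulr0.
Qed.

Lemma expect_condE_sqr J g :
  expect (fun x => condE J g x ^+ 2)
    = \sum_(S : {set 'I_n} | S \subset J) coef g S ^+ 2.
Proof.
by under eq_expect do rewrite condE_fourier; rewrite expect_sqr_char_sum.
Qed.

Lemma condE_setT g x : condE setT g x = g x.
Proof.
rewrite -[RHS](@expect_cst R n); apply: eq_expect => z; congr g.
by apply/ffunP => j; rewrite ffunE inE.
Qed.

Lemma condE_set0 g x : condE set0 g x = expect g.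
Proof.
by apply: eq_expect => z; congr g; apply/ffunP => j; rewrite ffunE inE.
Qed.

Lemma condE_flip i J g x : i \notin J -> condE J g (flip x i) = condE J g x.
Proof.
move=> iJ; apply: eq_expect => z; congr g; apply/ffunP => j; rewrite !ffunE.
by have [->|//] := eqVneq j i; rewrite (negbTE iJ).
Qed.

Lemma condE_comp_flip i J g x : i \notin J ->
  condE J (fun y => g (flip y i)) x = condE J g x.
Proof.
move=> iJ; rewrite -[RHS](expect_flip i); apply: eq_expect => z; congr g.
apply/ffunP => j; rewrite !ffunE.
by have [->|//] := eqVneq j i; rewrite (negbTE iJ).
Qed.

(** The martingale increment: revealing the coordinate i adds a term that is odd
    in x_i, as the remaining two factors do not depend on x_i. *)
Lemma condE_setU1 i J g x : i \notin J ->
  condE (i |: J) g x = condE J g x + pm1 R (x i) * condE J (cube_deriv i g) x.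
Proof.
move=> iJ.
have -> : condE J g x
    = condE J (fun y => g y / 2 + g (flip y i) / 2) x.
  transitivity (condE J (fun y => 2^-1 * g y) x
      + condE J (fun y => 2^-1 * g (flip y i)) x).
    rewrite (condE_comp_flip (fun y => 2^-1 * g y)) // /condE expectZ; lra.
  by rewrite -expectD; apply: eq_expect => z; ring.
rewrite /condE -expectZ -expectD; apply: eq_expect => z.
set y := mix J x z.
have yi : y i = z i by rewrite /y ffunE (negbTE iJ).
have -> : mix (i |: J) x z = if x i == z i then y else flip y i.
  apply/ffunP => j; have [->|ji] := eqVneq j i.
    rewrite ffunE setU11; case: (x i =P z i) => [->|/eqP xz] //.
    by rewrite flip_eq yi; move: xz; case: (x i); case: (z i).
  rewrite ffunE !inE (negbTE ji) /=.
  by case: (x i == z i); rewrite ?flip_neq // /y ffunE.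
rewrite /cube_deriv yi; case: (x i); case: (z i); rewrite /pm1 /=;
  by move: (g y) (g (flip y i)) => a b; lra.
Qed.

Lemma expect_condE_setU1 (b : R -> R -> R) i J g h : i \notin J ->
  expect (fun x => b (condE (i |: J) g x) (condE (i |: J) h x))
    = expect (fun x =>
        (b (condE J g x + condE J (cube_deriv i g) x)
           (condE J h x + condE J (cube_deriv i h) x)
         + b (condE J g x - condE J (cube_deriv i g) x)
             (condE J h x - condE J (cube_deriv i h) x)) / 2).
Proof.
move=> iJ.
have -> : expect (fun x => b (condE (i |: J) g x) (condE (i |: J) h x))
   = expect (fun x => 2^-1 * (b (condE (i |: J) g x) (condE (i |: J) h x)))
   + expect (fun x => 2^-1 * (b (condE (i |: J) g (flip x i))
        (condE (i |: J) h (flip x i)))).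
  rewrite (expect_flip i (fun x =>
    2^-1 * (b (condE (i |: J) g x) (condE (i |: J) h x)))) expectZ; lra.
rewrite -expectD; apply: eq_expect => x.
rewrite !condE_setU1 // !(condE_flip _ _ iJ) flip_eq pm1N !mulNr.
by case: (x i); rewrite /pm1 ?mul1r ?mulN1r ?opprK; lra.
Qed.
End Conditioning.

(** * Random orderings of the coordinates *)

Section Ordering.
Variables (R : realType) (n : nat).
Implicit Types (S J K : {set 'I_n}).

(** The probability that a given i is preceded by exactly the set J, with
    #|J| = k, in a uniformly random ordering of the n coordinates. *)
Definition prefix_weight (k : nat) : R := (n%:R * 'C(n.-1, k)%:R)^-1.

(** Along every ordering the increments of u telescope; this is the average of
    that identity over all orderings. *)
Lemma sum_reveal_telescope (u : {set 'I_n} -> R) :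
  \sum_(i < n) \sum_(J : {set 'I_n} | i \notin J)
    prefix_weight #|J| * (u (i |: J) - u J) = u setT - u set0.
Proof.
transitivity (\sum_(K : {set 'I_n}) (#|K|%:R * prefix_weight #|K|.-1
    - (n - #|K|)%:R * prefix_weight #|K|) * u K).
  under eq_bigr do under eq_bigr do rewrite mulrBr.
  under eq_bigr do rewrite sumrB.
  rewrite sumrB; under [RHS]eq_bigr do rewrite mulrBl.
  rewrite sumrB; congr (_ - _).
    transitivity (\sum_(i < n) \sum_(K : {set 'I_n} | i \in K)
        prefix_weight #|K|.-1 * u K).
      apply: eq_bigr => i _; symmetry.
      rewrite (reindex_onto (fun J => i |: J) (fun K : {set 'I_n} => K :\ i)) /=.
        apply: eq_big => [J|J]; rewrite setU11 /=.
          apply/eqP/idP => [<-|]; first by rewrite setD11.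
          exact: setU1K.
        move=> /eqP JE; have iJ : i \notin J by rewrite -JE setD11.
        by rewrite cardsU1 iJ.
      by move=> K iK; rewrite setD1K.
    rewrite (exchange_big_dep xpredT) //=; apply: eq_bigr => K _.
    by rewrite sumr_const -[LHS]mulr_natl mulrA.
  rewrite (exchange_big_dep xpredT) //=; apply: eq_bigr => K _.
  rewrite (eq_bigl (fun i => i \in ~: K)); last by move=> i; rewrite inE.
  by rewrite sumr_const cardsCs setCK card_ord -[LHS]mulr_natl mulrA.
have coefE K : #|K|%:R * prefix_weight #|K|.-1
    - (n - #|K|)%:R * prefix_weight #|K|
    = (K == setT)%:R - (K == set0)%:R.
  have kn : (#|K| <= n)%N by rewrite -[X in (_ <= X)%N](card_ord n) max_card.
  have bn0 : 'C(n, #|K|)%:R != 0 :> R by rewrite pnatr_eq0 -lt0n bin_gt0.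
  have -> : #|K|%:R * prefix_weight #|K|.-1
      = 'C(n, #|K|)%:R^-1 - (K == set0)%:R.
    have [->|K0] := eqVneq K set0.
      by rewrite cards0 mul0r bin0 invr1 subrr.
    rewrite subr0 /prefix_weight -natrM; have k0 : (0 < #|K|)%N by rewrite card_gt0.
    rewrite -[X in _ = ('C(n, X)%:R)^-1](prednK k0) mul_bin_diag prednK // natrM.
    by rewrite invfM mulVKf // pnatr_eq0 -lt0n.
  have -> : (n - #|K|)%:R * prefix_weight #|K|
      = 'C(n, #|K|)%:R^-1 - (K == setT)%:R.
    have [->|KT] := eqVneq K setT.
      by rewrite cardsT card_ord subnn mul0r binn invr1 subrr.
    have k0 : (0 < n - #|K|)%N.
      rewrite subn_gt0 ltn_neqAle kn andbT.
      apply: contra KT => /eqP Kn; rewrite eqEcard subsetT cardsT card_ord Kn.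
      by rewrite leqnn.
    rewrite subr0 /prefix_weight -natrM mul_bin_down natrM.
    by rewrite invfM mulVKf // pnatr_eq0 -lt0n.
  by ring.
under eq_bigr do rewrite coefE mulrBl.
rewrite sumrB (bigD1 setT) //= eqxx mul1r big1 ?addr0; last first.
  by move=> K /negbTE ->; rewrite mul0r.
rewrite (bigD1 set0) //= eqxx mul1r big1 ?addr0 //.
by move=> K /negbTE ->; rewrite mul0r.
Qed.

Lemma sum_by_card (i : 'I_n) (Q : pred {set 'I_n}) (P : pred nat)
    (F : nat -> R) :
  \sum_(J : {set 'I_n} | [&& i \notin J, Q J & P #|J|]) F #|J|
    = \sum_(k < n | P k)
        F k * #|[set J : {set 'I_n} | [&& i \notin J, Q J & #|J| == k]]|%:R.
Proof.
symmetry; transitivity (\sum_(k < n | P k)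
    \sum_(J : {set 'I_n} | [&& i \notin J, Q J & #|J| == k]) F k).
  apply: eq_bigr => k _; rewrite sumr_const mulr_natr; congr (_ *+ _).
  by apply: eq_card => J; rewrite !inE.
rewrite (exchange_big_dep (fun J : {set 'I_n} => [&& i \notin J, Q J & P #|J|])) /=.
  apply: eq_bigr => J /and3P[iJ QJ PJ].
  have Jn : (#|J| < n)%N.
    rewrite -[X in (_ < X)%N](card_ord n) -cardsT; apply: proper_card.
    by rewrite properEneq subsetT andbT; apply: contraNneq iJ => ->; rewrite inE.
  rewrite (big_pred1 (Ordinal Jn)) // => k /=.
  rewrite iJ QJ /= -val_eqE /= [RHS]eq_sym.
  by case: eqP => [<-|]; rewrite ?andbT ?andbF.
by move=> k J Pk /and3P[-> -> /eqP ->].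
Qed.

(** A uniform k-subset of m points contains j given points with at most the
    probability for independent inclusion.  The ratio (k + 1) / (m + 1) replaces
    k / m so that m = 0 causes no division by zero. *)
Lemma bin_ratio (m k j : nat) : (j <= k <= m)%N ->
  'C(m - j, k - j)%:R <= 'C(m, k)%:R * (k.+1%:R / m.+1%:R) ^+ j :> R.
Proof.
elim: j => [|j IH] /andP[jk km]; first by rewrite !subn0 expr0 mulr1.
have {}IH := IH (introT andP (conj (ltnW jk) km)).
have jm := leq_trans jk km.
rewrite exprSr mulrA.
apply: le_trans (ler_wpM2r (divr_ge0 (ler0n _ _) (ler0n _ _)) IH).
rewrite mulrA ler_pdivlMr ?ltr0n // -!natrM ler_nat.
have := mul_bin_diag (m - j) (k - j.+1).
rewrite -subnS (_ : (k - j.+1).+1 = k - j)%N; last by lia.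
set b := 'C(_, _); set c := 'C(_, _) => bc.
have mj : (0 < m - j)%N by lia.
rewrite -(leq_pmul2l mj) mulnA bc.
have : ((k - j) * m.+1 <= (m - j) * k.+1)%N by nia.
by nia.
Qed.

Lemma card_prefix_containing (i : 'I_n) S k : (k < n)%N ->
  #|[set J : {set 'I_n} | [&& i \notin J, S \subset J & #|J| == k]]|%:R
    <= 'C(n.-1, k)%:R * (k.+1%:R / n%:R) ^+ #|S| :> R.
Proof.
move=> kn; set X := [set J | _].
have rhs0 : 0 <= 'C(n.-1, k)%:R * (k.+1%:R / n%:R) ^+ #|S| :> R.
  by rewrite mulr_ge0 ?exprn_ge0 ?divr_ge0.
have [/existsP[J JX]|/existsPn X0] := boolP [exists J, J \in X]; last first.
  by rewrite (_ : X = set0) ?cards0 //; apply/setP => J; rewrite [RHS]inE (negbTE (X0 J)).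
have [iS Sk] : i \notin S /\ (#|S| <= k)%N.
  move: JX; rewrite inE => /and3P[iJ SJ /eqP <-]; split.
    by apply: contra iJ => /(subsetP SJ).
  exact: subset_leq_card.
have n0 : (0 < n)%N by apply: leq_trans kn.
have := @bin_ratio n.-1 k #|S|; rewrite prednK // Sk -ltnS prednK // kn.
move=> /(_ isT); apply: le_trans; rewrite ler_nat.
have -> : (n.-1 - #|S| = #|~: (i |: S)|)%N.
  by rewrite [RHS]cardsCs setCK cardsU1 iS card_ord subnDA subn1.
rewrite -cards_draws -(@card_in_imset _ _ (fun J => J :\: S)).
  apply: subset_leq_card; apply/subsetP => A /imsetP[K].
  rewrite inE => /and3P[iK SK /eqP cK] ->.
  rewrite inE; apply/andP; split.
    apply/subsetP => j; rewrite !inE => /andP[jS jK].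
    by rewrite negb_or jS andbT; apply: contraNneq iK => <-.
  by rewrite cardsD (setIidPr SK) cK.
move=> K1 K2; rewrite !inE => /and3P[_ S1 _] /and3P[_ S2 _] E.
by rewrite -(setID K1 S) -(setID K2 S) (setIidPr S1) (setIidPr S2) E.
Qed.

Lemma prefix_weight_bin k : (k < n)%N ->
  prefix_weight k * 'C(n.-1, k)%:R = n%:R^-1.
Proof.
move=> kn; rewrite /prefix_weight invfM -mulrA mulVf ?mulr1 //.
by rewrite pnatr_eq0 -lt0n bin_gt0; lia.
Qed.

Lemma prefix_weight_ge0 k : 0 <= prefix_weight k.
Proof. by rewrite invr_ge0 mulr_ge0. Qed.

(** The second moment of condE J g is the sum of the squared coefficients over
    S \subset J, and S lies in a random set of size k with probability at most
    (k.+1 / n) ^ #|S|: conditioning on it is dominated by noise. *)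
Lemma prefix_sum_noise (i : 'I_n) (P : pred nat) (g : cube n -> R) :
  \sum_(J : {set 'I_n} | (i \notin J) && P #|J|)
     prefix_weight #|J| * expect (fun x => condE J g x ^+ 2)
   <= \sum_(k < n | P k) n%:R^-1 * noise_norm (k.+1%:R / n%:R) g.
Proof.
under eq_bigr do rewrite expect_condE_sqr mulr_sumr.
rewrite (exchange_big_dep xpredT) //=.
rewrite (eq_bigr (fun S : {set 'I_n} => coef g S ^+ 2 * \sum_(k < n | P k)
  prefix_weight k * #|[set J : {set 'I_n} |
     [&& i \notin J, S \subset J & #|J| == k]]|%:R)); last first.
  move=> S _; rewrite -sum_by_card mulr_sumr.
  by apply: eq_big => J; rewrite ?andbA 1?[RHS]andbAC // mulrC.
under [X in _ <= X]eq_bigr do rewrite /noise_norm mulr_sumr.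
rewrite [X in _ <= X]exchange_big /=; apply: ler_sum => S _.
rewrite mulr_sumr; apply: ler_sum => k _.
rewrite mulrC [X in _ <= X]mulrA; apply: ler_wpM2r; first exact: sqr_ge0.
apply: (le_trans (ler_wpM2l (prefix_weight_ge0 k)
  (card_prefix_containing i S (ltn_ord k)))).
by rewrite mulrA prefix_weight_bin.
Qed.

Lemma prefix_sum_card (i : 'I_n) (P : pred nat) :
  \sum_(J : {set 'I_n} | (i \notin J) && P #|J|) prefix_weight #|J|
   <= \sum_(k < n | P k) n%:R^-1.
Proof.
rewrite (eq_bigl (fun J : {set 'I_n} => [&& i \notin J, set0 \subset J & P #|J|]));
  last by move=> J; rewrite sub0set.
rewrite sum_by_card; apply: ler_sum => k _.
apply: (le_trans (ler_wpM2l (prefix_weight_ge0 k)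
  (card_prefix_containing i set0 (ltn_ord k)))).
by rewrite cards0 expr0 mulr1 prefix_weight_bin.
Qed.
End Ordering.

(** * Sums over the steps of the process *)

Section Estimates.
Variable R : realType.

Lemma expR_half_le2 : expR (1 / 2) <= 2 :> R.
Proof.
have h := expR_ge1Dx (- (1 / 2) : R).
have := expRD (1 / 2) (- (1 / 2) : R); rewrite subrr expR0.
by have := expR_gt0 (1 / 2 : R); nra.
Qed.

Lemma sum_geometric_le (q : R) (n : nat) : 0 <= q < 1 ->
  \sum_(l < n) q ^+ l <= (1 - q)^-1.
Proof.
move=> /andP[q0 q1]; have q1' : 0 < 1 - q by lra.
rewrite -(ler_pM2l q1') mulfV ?lt0r_neq0 //.
have := subrX1 q n; have := exprn_ge0 n q0.
by move: (q ^+ n) (\sum_(l < n) q ^+ l) => a b; nra.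
Qed.

Lemma sum_lt_le (a : R) (n : nat) : 0 <= a ->
  \sum_(l < n | l%:R < a) 1 <= a + 1 :> R.
Proof.
move=> a0; elim: n => [|n IH]; first by rewrite big_ord0; lra.
rewrite big_mkcond big_ord_recr /= -big_mkcond /=.
case: ifP => [na|_]; last by rewrite addr0.
apply: (@le_trans _ _ (n%:R + 1)); last by lra.
rewrite lerD2r big_mkcond; apply: (@le_trans _ _ (\sum_(l < n) 1)).
  by apply: ler_sum => l _; case: ifP.
by rewrite sumr_const card_ord.
Qed.

(** A geometric series of ratio about 1 - (1 + L) / (8 n), where half of the decay
    is spent on the factor expR (- A / 8) by means of the condition on l.  The
    bound L <= n absorbs the error 1 / n of the discretization. *)
Lemma sum_early_le (n : nat) (A L : R) : (0 < n)%N -> 0 <= A -> 0 <= L <= n%:R ->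
  \sum_(l < n | A * n%:R <= l%:R * (1 + L))
      n%:R^-1 * expR (- (L * (l%:R / n%:R) / 4))
    <= 20 * expR (- (A / 8)) / (1 + L).
Proof.
move=> n0 A0 /andP[L0 Ln].
have N0 : 0 < n%:R :> R by rewrite ltr0n.
have N1 : 1 <= n%:R :> R by rewrite ler1n.
have iN0 : 0 < n%:R^-1 :> R by rewrite invr_gt0.
have NiN : n%:R * n%:R^-1 = 1 :> R by rewrite mulfV ?lt0r_neq0.
move: (n%:R^-1 : R) iN0 NiN => iN iN0 NiN.
set z := (1 + L) * iN / 8.
have z0 : 0 < z by rewrite /z; apply: divr_gt0 => //; apply: mulr_gt0; lra.
have e4 : expR (1 / 4) <= 2 :> R.
  by apply: le_trans expR_half_le2; rewrite ler_expR; lra.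
apply: (@le_trans _ _ (\sum_(l < n) iN * (2 * expR (- (A / 8)) * expR (- z) ^+ l))).
  rewrite big_mkcond; apply: ler_sum => l _; case: ifPn => [Al|_]; last first.
    by rewrite ?mulr_ge0 ?exprn_ge0 ?expR_ge0 // ltW.
  rewrite ler_pM2l //.
  apply: (@le_trans _ _ (expR (1 / 4) * expR (- (A / 8)) * expR (- z) ^+ l)); last first.
    by rewrite ler_wpM2r ?exprn_ge0 ?expR_ge0 // ler_wpM2r ?expR_ge0.
  rewrite -expRM_natl -!expRD ler_expR.
  have ln : l%:R <= n%:R :> R by rewrite ler_nat ltnW.
  have lN1 : l%:R * iN <= 1.
    by rewrite -[X in _ <= X]NiN; exact: ler_wpM2r (ltW iN0) _ _ ln.
  have AlN : A <= l%:R * (1 + L) * iN.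
    by have := ler_wpM2r (ltW iN0) Al; rewrite -[A * _ * _]mulrA NiN mulr1.
  rewrite /z; move: (l%:R : R) lN1 AlN => x h1 h2.
  by nra.
rewrite -mulr_sumr -mulr_sumr.
have ez : expR (- z) <= (1 + z)^-1.
  by rewrite expRN lef_pV2 ?posrE ?expR_gt0 ?expR_ge1Dx //; lra.
have q1 : 0 < 1 - (1 + z)^-1.
  by rewrite subr_gt0 invf_lt1; lra.
have geo : \sum_(l < n) expR (- z) ^+ l <= 1 + z^-1.
  apply: (le_trans (sum_geometric_le _ _)).
    by rewrite expR_ge0 /=; lra.
  apply: (@le_trans _ _ ((1 - (1 + z)^-1)^-1)).
    by rewrite lef_pV2 ?posrE //; lra.
  rewrite le_eqVlt; apply/orP; left; apply/eqP; field.
  by rewrite !lt0r_neq0 //; lra.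
have c0 : 0 <= 2 * expR (- (A / 8)) :> R by rewrite mulr_ge0 ?expR_ge0.
apply: (le_trans (ler_wpM2l (ltW iN0) (ler_wpM2l c0 geo))).
have iNz : iN * z^-1 = 8 / (1 + L).
  have iNn : iN != 0 by rewrite lt0r_neq0.
  by rewrite /z; field; rewrite iNn andbT lt0r_neq0 //; lra.
have iN2 : iN <= 2 / (1 + L).
  rewrite ler_pdivlMr; last by lra.
  by nra.
rewrite (_ : iN * _ = 2 * expR (- (A / 8)) * (iN + iN * z^-1)); last by ring.
rewrite iNz (_ : 20 * _ / _ = 2 * expR (- (A / 8)) * (2 / (1 + L) + 8 / (1 + L))).
  by apply: ler_wpM2l => //; rewrite lerD2r.
by field; rewrite lt0r_neq0 //; lra.
Qed.

Lemma sum_late_le (n : nat) (A L : R) : (0 < n)%N -> 0 <= A -> 0 <= L <= n%:R ->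
  \sum_(l < n | ~~ (A * n%:R <= l%:R * (1 + L))) n%:R^-1 <= (A + 2) / (1 + L).
Proof.
move=> n0 A0 /andP[L0 Ln].
have N0 : 0 < n%:R :> R by rewrite ltr0n.
have N1 : 1 <= n%:R :> R by rewrite ler1n.
have L1 : 0 < 1 + L by lra.
rewrite (eq_bigl (fun l : 'I_n => l%:R < A * n%:R / (1 + L))); last first.
  by move=> l; rewrite -ltNge ltr_pdivlMr.
rewrite (eq_bigr (fun=> n%:R^-1 * 1)); last by move=> l _; rewrite mulr1.
rewrite -mulr_sumr.
have a0 : 0 <= A * n%:R / (1 + L) by rewrite divr_ge0 ?mulr_ge0 // ltW.
have iN0 : 0 <= n%:R^-1 :> R by rewrite invr_ge0 ltW.
apply: (le_trans (ler_wpM2l iN0 (sum_lt_le n a0))).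
rewrite mulrDr mulr1 mulrDl lerD //.
  rewrite mulrA [_ * (A * _)]mulrC mulfK ?lt0r_neq0 //.
by rewrite ler_pdivlMr // mulrC ler_pdivrMr //; lra.
Qed.
End Estimates.

(** * Energy of the revealment steps of a Boolean function *)

Section BooleanFunctions.
Variables (R : realType) (n : nat) (f : cube n -> bool).
Implicit Types (x y : cube n) (i : 'I_n) (J : {set 'I_n}).

Let F x : R := pm1 R (f x).

Lemma VarE : Var R f = expect (fun x => F x ^+ 2) - expect F ^+ 2.
Proof.
rewrite /Var /variance -/F; set m := expect F.
rewrite (@eq_expect _ _ _ (fun x => F x ^+ 2 + (- (2 * m) * F x + m ^+ 2))).
  by rewrite !expectD expectZ expect_cst -/m; ring.
by move=> x; rewrite -/(F x); ring.
Qed.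

Lemma derivE i x :
  cube_deriv i F x = if f x == f (flip x i) then 0 else pm1 R (x i) * F x.
Proof.
rewrite /cube_deriv /F.
by case: (f x); case: (f (flip x i)); case: (x i); rewrite /pm1 /=; lra.
Qed.

Lemma deriv_cube i x : cube_deriv i F x ^+ 3 = cube_deriv i F x.
Proof.
rewrite derivE; case: ifP => _; first by rewrite expr0n.
by rewrite exprS exprMn !pm1_sqr !mulr1.
Qed.

Lemma expect_deriv_sqr i : expect (fun x => cube_deriv i F x ^+ 2) = Inf R f i.
Proof.
rewrite /Inf -expect_mem; apply: eq_expect => x; rewrite derivE inE.
by case: eqP => _; rewrite ?expr0n // exprMn !pm1_sqr mulr1.
Qed.

Lemma Inf_ge0 i : 0 <= Inf R f i.
Proof. by rewrite -expect_deriv_sqr; apply: expect_ge0 => x; apply: sqr_ge0. Qed.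

(** The upper bound n holds because a nonzero influence is at least 2 ^ - n. *)
Lemma Inf_bounds i : Inf R f i != 0 ->
  0 <= ln (1 / Inf R f i) <= n%:R /\ Inf R f i = expR (- ln (1 / Inf R f i)).
Proof.
move=> I0; have Ipos : 0 < Inf R f i by rewrite lt_neqAle eq_sym I0 Inf_ge0.
have Vpos : 1 / Inf R f i \is Num.pos by rewrite posrE divr_gt0.
split; last by rewrite expRN lnK // div1r invrK.
apply/andP; split.
  apply: ln_ge0; rewrite div1r invf_ge1 //.
  by rewrite /Inf /mu ler_pdivrMr ?card_cube_gt0 // mul1r ler_nat max_card.
rewrite -ler_expR lnK // /Inf /mu div1r invf_div ler_pdivrMr; last first.
  by rewrite ltr0n lt0n; apply: contra I0 => /eqP I0; rewrite /Inf /mu I0 mul0r.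
apply: (@le_trans _ _ (expR n%:R * 1)).
  rewrite mulr1 card_ffun card_bool card_ord natrX -[X in expR X]mulr1 expRM_natl.
  by apply: lerXn2r; rewrite ?nnegrE ?expR_ge0 //; have := expR_ge1Dx (1 : R); lra.
apply: ler_wpM2l; first exact: expR_ge0.
rewrite ler1n lt0n; apply: contra I0 => /eqP I0.
by rewrite /Inf /mu I0 mul0r.
Qed.

Definition energy i J : R := expect (fun x => condE J (cube_deriv i F) x ^+ 2).

Lemma energy_ge0 i J : 0 <= energy i J.
Proof. by apply: expect_ge0 => x; apply: sqr_ge0. Qed.

Lemma energy_le_Inf i J : energy i J <= Inf R f i.
Proof.
rewrite /energy expect_condE_sqr -expect_deriv_sqr parseval [X in X <= _]big_mkcond.
by apply: ler_sum => S _; case: ifP => // _; apply: sqr_ge0.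
Qed.

Lemma Var_energy :
  Var R f = \sum_(i < n) \sum_(J : {set 'I_n} | i \notin J)
    prefix_weight R n #|J| * energy i J.
Proof.
rewrite VarE; have := sum_reveal_telescope (fun J => expect (fun x => condE J F x ^+ 2)).
rewrite (@eq_expect _ _ (fun x => condE setT F x ^+ 2) (fun x => F x ^+ 2));
  last by move=> x; rewrite condE_setT.
rewrite (@eq_expect _ _ (fun x => condE set0 F x ^+ 2) (fun=> expect F ^+ 2));
  last by move=> x; rewrite condE_set0.
rewrite expect_cst => <-; apply: eq_bigr => i _; apply: eq_bigr => J iJ.
congr (_ * _).
rewrite (expect_condE_setU1 (fun a _ => a ^+ 2) F F iJ) -expectN -expectD.
by apply: eq_expect => x; field.
Qed.

(** With M and N the conditional expectations of F and of the indicator of D, the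
    function max (0, M^2 + N / lam - 1) is convex, hence never decreases on
    average along the process, and it is M^2 plus an affine function of N where
    N >= lam, hence it grows there by at least the squared increment of M.  It
    starts nonnegative and ends at 1_D / lam because M = +-1 at the end. *)
Lemma energy_high_density (D : {set cube n}) (lam : R) : 0 < lam ->
  \sum_(i < n) \sum_(J : {set 'I_n} | i \notin J) prefix_weight R n #|J| *
     expect (fun x => if lam <= condE J (fun y => (y \in D)%:R) x
                      then condE J (cube_deriv i F) x ^+ 2 else 0)
   <= mu R D / lam.
Proof.
move=> lam0; pose oneD y : R := (y \in D)%:R.
pose b (M N : R) := Num.max 0 (M ^+ 2 + N / lam - 1).
have b0 M N : 0 <= b M N by rewrite /b le_max lexx.
have bM M N : M ^+ 2 + N / lam - 1 <= b M N by rewrite /b le_max lexx orbT.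
pose u J := expect (fun x => b (condE J F x) (condE J oneD x)).
have -> : mu R D / lam = u setT.
  rewrite mulrC -expect_mem -expectZ; apply: eq_expect => x.
  rewrite !condE_setT /b /F pm1_sqr addrAC subrr add0r mulrC.
  by rewrite max_r // divr_ge0 ?ler0n // ltW.
apply: (@le_trans _ _ (u setT - u set0)); last first.
  by rewrite gerBl; apply: expect_ge0 => x.
rewrite -sum_reveal_telescope; apply: ler_sum => i _; apply: ler_sum => J iJ.
apply: ler_wpM2l; first exact: prefix_weight_ge0.
rewrite /u (expect_condE_setU1 b F oneD iJ) -expectN -expectD.
apply: le_expect => x.
move: (condE J F x) (condE J oneD x) (condE J (cube_deriv i F) x)
  (condE J (cube_deriv i oneD) x) => M N m k.
have p1 := bM (M + m) (N + k); have p2 := bM (M - m) (N - k).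
have p3 := b0 (M + m) (N + k); have p4 := b0 (M - m) (N - k).
have pD : (N + k) / lam + (N - k) / lam = 2 * (N / lam) by ring.
have [c0|c0] := leP 0 (M ^+ 2 + N / lam - 1).
  have -> : b M N = M ^+ 2 + N / lam - 1 by rewrite /b max_r.
  by have := sqr_ge0 m; case: ifP => _; nra.
have -> : b M N = 0 by rewrite /b max_l // ltW.
case: ifP => [lN|_]; last by lra.
have : 1 <= N / lam by rewrite ler_pdivlMr // mul1r.
by have := sqr_ge0 M; lra.
Qed.

(** Both vertex boundaries at once: the inner one for true, the outer one for
    false, up to conversion. *)
Definition crossing_set (b : bool) : {set cube n} :=
  [set y | [exists i : 'I_n, (f y == b) && (f (flip y i) == ~~ b)]].

(** Averaging over x_i is part of condE J, so the derivative may be concentrated,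
    with a factor 2, on the endpoint of each cut edge where f equals b.  The
    resulting phi is supported on the crossing set, and Cauchy-Schwarz bounds the
    square of its conditional expectation by the density of that set times the
    conditional second moment of phi. *)
Lemma energy_low_density (b : bool) (lam : R) i J : 0 <= lam -> i \notin J ->
  expect (fun x => if lam <= condE J (fun y => (y \in crossing_set b)%:R) x
                   then 0 else condE J (cube_deriv i F) x ^+ 2)
   <= 2 * lam * Inf R f i.
Proof.
move=> lam0 iJ; pose oneD y : R := (y \in crossing_set b)%:R.
pose cr y : R := ((f y == b) && (f (flip y i) == ~~ b))%:R.
pose phi y := 2 * cr y * cube_deriv i F y.
have dflip y : cube_deriv i F (flip y i) = cube_deriv i F y.
  rewrite /cube_deriv flipK flip_eq pm1N; ring.
have crD y : (cr y + cr (flip y i)) * cube_deriv i F y = cube_deriv i F y.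
  rewrite derivE /cr flipK; case: (f y); case: (f (flip y i)); case: (b) => /=;
    by rewrite ?mulr0 ?addr0 ?add0r ?mul1r.
have condphi x : condE J (cube_deriv i F) x = condE J phi x.
  transitivity (condE J (fun y => 2^-1 * phi y) x
      + condE J (fun y => 2^-1 * phi (flip y i)) x).
    rewrite /condE -expectD; apply: eq_expect => z.
    by rewrite -crD /phi dflip; field.
  rewrite (condE_comp_flip (fun y => 2^-1 * phi y) _ iJ) /condE expectZ; lra.
have phi2 : expect (fun y => phi y ^+ 2) = 2 * Inf R f i.
  have cr2 y : cr y ^+ 2 = cr y by rewrite /cr; case: (_ && _); rewrite ?expr0n ?expr1n.
  transitivity (4 * expect (fun y => cr y * cube_deriv i F y ^+ 2)).
    rewrite -expectZ; apply: eq_expect => y.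
    by rewrite /phi !exprMn cr2; ring.
  have <- : 2 * expect (fun y => cr y * cube_deriv i F y ^+ 2) = Inf R f i.
    transitivity (expect (fun y => cr y * cube_deriv i F y ^+ 2)
       + expect (fun y => cr (flip y i) * cube_deriv i F (flip y i) ^+ 2)).
      rewrite (expect_flip i (fun y => cr y * cube_deriv i F y ^+ 2)); ring.
    rewrite -expectD -expect_deriv_sqr; apply: eq_expect => y.
    by rewrite dflip -mulrDl expr2 mulrA crD.
  ring.
apply: (@le_trans _ _ (expect (fun x => lam * condE J (fun y => phi y ^+ 2) x))).
  apply: le_expect => x.
  have c0 : 0 <= condE J (fun y => phi y ^+ 2) x.
    by apply: expect_ge0 => z; apply: sqr_ge0.
  case: ifPn => [_|]; first exact: mulr_ge0.
  rewrite -ltNge => /ltW Nlam; rewrite condphi.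
  apply: (@le_trans _ _ (condE J oneD x * condE J (fun y => phi y ^+ 2) x)); last first.
    exact: ler_wpM2r.
  have oneD2 y : oneD y ^+ 2 = oneD y.
    by rewrite /oneD; case: (_ \in _); rewrite ?expr0n ?expr1n.
  have phiD y : phi y = oneD y * phi y.
    rewrite /oneD; case: (boolP (y \in _)) => [_|]; first by rewrite mul1r.
    rewrite inE => /existsPn/(_ i)/negbTE cr0.
    by rewrite /phi /cr cr0 mulr0 !mul0r.
  rewrite /condE (eq_expect (fun z => phiD (mix J x z))).
  apply: (le_trans (expect_CauchySchwarz _ _)).
  by rewrite (eq_expect (fun z => oneD2 (mix J x z))).
by rewrite expectZ expect_condE phi2 mulrCA mulrA.
Qed.

(** With k coordinates revealed before i, n.-1 - k others are still to come. *)
Definition early (A : R) i (k : nat) : bool :=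
  A * n%:R <= (n.-1 - k)%:R * (1 + ln (1 / Inf R f i)).

Lemma sum_rev_pred (P : pred nat) (G : nat -> R) :
  \sum_(k < n | P (n.-1 - k)%N) G (n.-1 - k)%N = \sum_(l < n | P l) G l.
Proof.
have E (k : 'I_n) : rev_ord k = (n.-1 - k)%N :> nat by rewrite /= subnS; lia.
by rewrite [RHS](reindex_inj rev_ord_inj); apply: eq_big => k; rewrite E.
Qed.

Lemma early_energy (A : R) : 0 <= A ->
  \sum_(i < n | Inf R f i != 0) \sum_(J : {set 'I_n} | (i \notin J) && early A i #|J|)
    prefix_weight R n #|J| * energy i J
  <= 20 * expR (- (A / 8)) * talagrand_sum R f.
Proof.
move=> A0; rewrite /talagrand_sum mulr_sumr; apply: ler_sum => i I0.
have [L01 IE] := Inf_bounds I0.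
apply: (le_trans (prefix_sum_noise _ _ _)).
have n0 : (0 < n)%N by apply: leq_ltn_trans (ltn_ord i).
have N0 : n%:R != 0 :> R by rewrite pnatr_eq0 -lt0n.
set L := ln _ in L01 IE *.
pose G l : R := n%:R^-1 * expR (- (L * (l%:R / n%:R) / 4)).
apply: (@le_trans _ _ (\sum_(k < n | early A i k) Inf R f i * G (n.-1 - k)%N)).
  apply: ler_sum => k _; rewrite /G mulrCA; apply: ler_wpM2l; first by rewrite invr_ge0.
  have sE : 1 - k.+1%:R / n%:R = (n.-1 - k)%:R / n%:R :> R.
    rewrite -{1}(mulfV N0) -mulrBl -natrB //; congr (_%:R / _); lia.
  rewrite -sE {1}IE; apply: noise_norm_small_set.
  - exact: deriv_cube.
  - by rewrite expect_deriv_sqr.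
  - by rewrite divr_ge0 //= ler_pdivrMr ?ltr0n // mul1r ler_nat.
rewrite -mulr_sumr (sum_rev_pred (fun l => A * n%:R <= l%:R * (1 + L)) G).
apply: (le_trans (ler_wpM2l (Inf_ge0 i) (sum_early_le n0 A0 L01))).
by rewrite le_eqVlt; apply/orP; left; apply/eqP; ring.
Qed.

(** Each late step is split according to the density of the crossing set; the dense
    part is bounded by its total over all steps, early ones included. *)
Lemma late_energy (A lam : R) (b : bool) : 0 <= A -> 0 < lam ->
  \sum_(i < n | Inf R f i != 0) \sum_(J : {set 'I_n} | (i \notin J) && ~~ early A i #|J|)
    prefix_weight R n #|J| * energy i J
  <= mu R (crossing_set b) / lam + 2 * lam * (A + 2) * talagrand_sum R f.
Proof.
move=> A0 lam0; apply: le_trans (lerD (energy_high_density _ lam0) (lexx _)).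
pose N J x : R := condE J (fun y => (y \in crossing_set b)%:R) x.
pose hi i J := expect (fun x => if lam <= N J x
  then condE J (cube_deriv i F) x ^+ 2 else 0).
have hi0 i J : 0 <= hi i J.
  by apply: expect_ge0 => x; case: ifP => // _; apply: sqr_ge0.
have whi0 i J : 0 <= prefix_weight R n #|J| * hi i J.
  by rewrite mulr_ge0 ?prefix_weight_ge0.
apply: (@le_trans _ _ (\sum_(i < n | Inf R f i != 0)
   (\sum_(J : {set 'I_n} | i \notin J) prefix_weight R n #|J| * hi i J
   + 2 * lam * Inf R f i * ((A + 2) / (1 + ln (1 / Inf R f i)))))).
  apply: ler_sum => i I0; have [L01 _] := Inf_bounds I0.
  have n0 : (0 < n)%N by apply: leq_ltn_trans (ltn_ord i).
  apply: (@le_trans _ _ (\sum_(J : {set 'I_n} | (i \notin J) && ~~ early A i #|J|)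
    (prefix_weight R n #|J| * hi i J + 2 * lam * Inf R f i * prefix_weight R n #|J|))).
    apply: ler_sum => J /andP[iJ _].
    rewrite [2 * _ * _ * _]mulrC -mulrDr.
    apply: ler_wpM2l; first exact: prefix_weight_ge0.
    apply: le_trans (lerD (lexx _) (energy_low_density b (ltW lam0) iJ)).
    rewrite -expectD; apply: le_expect => x.
    by case: ifP => _; rewrite ?addr0 ?add0r.
  rewrite big_split /=; apply: lerD.
    rewrite [X in _ <= X](bigID (fun J : {set 'I_n} => early A i #|J|)) /= lerDr.
    exact: sumr_ge0.
  rewrite -mulr_sumr; apply: ler_wpM2l.
    exact: mulr_ge0 (mulr_ge0 (ler0n _ _) (ltW lam0)) (Inf_ge0 i).
  apply: (le_trans (prefix_sum_card _ _ (fun k => ~~ early A i k))).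
  rewrite (sum_rev_pred (fun l => ~~ (A * n%:R <= l%:R * (1 + ln (1 / Inf R f i))))
    (fun=> n%:R^-1)).
  exact: sum_late_le.
rewrite big_split /=; apply: lerD.
  rewrite [X in _ <= X](bigID (fun i => Inf R f i != 0)) /= lerDl.
  by apply: sumr_ge0 => i _; apply: sumr_ge0 => J _; exact: whi0.
rewrite /talagrand_sum mulr_sumr le_eqVlt; apply/orP; left; apply/eqP.
by apply: eq_bigr => i _; ring.
Qed.

Lemma Var_early_late (A : R) :
  Var R f =
  \sum_(i < n | Inf R f i != 0) \sum_(J : {set 'I_n} | (i \notin J) && early A i #|J|)
    prefix_weight R n #|J| * energy i J +
  \sum_(i < n | Inf R f i != 0) \sum_(J : {set 'I_n} | (i \notin J) && ~~ early A i #|J|)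
    prefix_weight R n #|J| * energy i J.
Proof.
rewrite Var_energy -big_split (bigID (fun i => Inf R f i != 0)) /=.
rewrite [X in _ + X]big1 ?addr0.
  by apply: eq_bigr => i _; rewrite (bigID (fun J : {set 'I_n} => early A i #|J|)).
move=> i; rewrite negbK => /eqP I0; apply: big1 => J _.
have /eqP -> : energy i J == 0 by rewrite eq_le energy_ge0 andbT -I0 energy_le_Inf.
by rewrite mulr0.
Qed.

Lemma Var_gt0 : nonconstant f -> 0 < Var R f.
Proof.
move=> fnc; rewrite /Var /variance -/F; set m := expect F.
have d0 x : 0 <= (F x - m) ^+ 2 by apply: sqr_ge0.
rewrite lt_neqAle (expect_ge0 d0) andbT eq_sym; apply/negP.
rewrite expectE mulf_eq0 invr_eq0 (gt_eqF (card_cube_gt0 _ _)).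
rewrite orbF psumr_eq0; last by move=> x _; apply: d0.
move=> /allP Fm; apply: fnc.
have FE x : F x = m.
  by have := Fm x (mem_index_enum x); rewrite /= sqrf_eq0 subr_eq0 => /eqP.
pose x0 : cube n := [ffun=> true]; exists (f x0) => y.
have : F y = F x0 by rewrite !FE.
by rewrite /F; case: (f y); case: (f x0) => //=; rewrite /pm1; lra.
Qed.

Lemma talagrand_inequality : Var R f <= 20 * talagrand_sum R f.
Proof.
have := early_energy (lexx 0); rewrite mul0r oppr0 expR0 mulr1; apply: le_trans.
rewrite (Var_early_late 0) [X in _ + X]big1 ?addr0 // => i I0.
apply: big1_seq => J /andP[/andP[_ nE] _]; case/negP: nE.
rewrite /early mul0r mulr_ge0 //.
by have [/andP[L0 _] _] := Inf_bounds I0; lra.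
Qed.

(** The trade-off between the three classes of steps: A and lam are free. *)
Lemma crossing_set_bound (A lam : R) (b : bool) : 0 <= A -> 0 < lam ->
  Var R f <= 20 * expR (- (A / 8)) * talagrand_sum R f
    + mu R (crossing_set b) / lam + 2 * lam * (A + 2) * talagrand_sum R f.
Proof.
move=> A0 lam0; rewrite (Var_early_late A) -addrA.
by apply: lerD; [apply: early_energy | apply: late_energy].
Qed.
End BooleanFunctions.


(* The conjunct 0 < ln (C_B / r_Tal) says that the denominator of the bound is
   positive: otherwise the right-hand side would be a junk or negative value. *)
Theorem theorem5 (R : realType) :
  exists C_B : R, 0 < C_B /\
    forall (n : nat) (f : cube n -> bool),
      (1 <= n)%N -> nonconstant f ->
      [/\ 0 < ln (C_B / r_Tal R f),
          r_Tal R f / (C_B * ln (C_B / r_Tal R f)) * Var R f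
            <= mu R (inner_boundary f)
        & r_Tal R f / (C_B * ln (C_B / r_Tal R f)) * Var R f
            <= mu R (outer_boundary f)].
Proof.
(* With l = ln (40 / r) >= 1/2 the constant must satisfy 32 (8 l + 2) <= C_B l,
   which holds from 384 on. *)
exists 400; split=> [//|n f _ fnc].
have V0 := Var_gt0 R fnc; have TV := talagrand_inequality R f.
have T0 : 0 < talagrand_sum R f by lra.
set r := r_Tal R f; have rE : r * talagrand_sum R f = Var R f.
  by rewrite /r /r_Tal divfK ?lt0r_neq0.
have r0 : 0 < r by apply: divr_gt0.
have r20 : r <= 20 by rewrite /r /r_Tal ler_pdivrMr.
set l := ln (40 / r).
have l2 : 1 / 2 <= l.
  rewrite -ler_expR lnK ?posrE ?divr_gt0 //; apply: (le_trans (expR_half_le2 R)).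
  by rewrite ler_pdivlMr //; lra.
have lL : l <= ln (400 / r).
  by rewrite ler_ln ?posrE ?divr_gt0 // ler_pM2r ?invr_gt0 //; lra.
have el : expR (- l) = r / 40 by rewrite expRN lnK ?posrE ?divr_gt0 // invf_div.
set L := ln (400 / r) in lL *.
have main b : r / (400 * L) * Var R f <= mu R (crossing_set f b).
  have A0 : 0 <= 8 * l by lra.
  have B0 : 0 < 8 * (8 * l + 2) by lra.
  have lam0 : 0 < r / (8 * (8 * l + 2)) by apply: divr_gt0.
  have := crossing_set_bound f b A0 lam0.
  rewrite (_ : 8 * l / 8 = l); last by field.
  rewrite el (_ : 20 * (r / 40) * talagrand_sum R f = Var R f / 2); last first.
    by rewrite -rE; field.
  rewrite (_ : 2 * (r / (8 * (8 * l + 2))) * (8 * l + 2) * talagrand_sum R f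
     = Var R f / 4); last first.
    by rewrite -rE; field; rewrite lt0r_neq0 //; lra.
  set m := mu _ _ => h.
  have h1 : Var R f / 4 <= m / (r / (8 * (8 * l + 2))) by lra.
  rewrite ler_pdivlMr // in h1; apply: le_trans h1.
  rewrite (_ : _ / 4 * _ = r / (4 * (8 * (8 * l + 2))) * Var R f); last first.
    by field; rewrite lt0r_neq0 //; lra.
  rewrite ler_pM2r // ler_pM2l // lef_pV2 ?posrE; lra.
split; first by lra.
- exact: (main true).
- exact: (main false).
Qed.
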